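(* If $F:[0,1]\to\mathcal{K}(\mathbb{R})$ is a set-valued Lipschitz map with Lipschitz constant $l$, and $\mathcal{G}(F)=\{(u,F(u)):u\in[0,1]\}\subset[0,1]\times\mathcal{K}(\mathbb{R})$, then $\dim_H(\mathcal{G}(F))=1$.
   Context: $\mathcal{K}(\mathbb{R})$ is the collection of nonempty compact subsets of $\mathbb{R}$, with the Hausdorff metric $H_d$. Lipschitz means $H_d(F(u),F(w))\le l|u-w|$ for all $u,w$. The graph $\mathcal{G}(F)$ carries the metric $D_{\mathcal{G}}((u,F(u)),(w,F(w)))=|u-w|+H_d(F(u),F(w))$, and $\dim_H$ is the Hausdorff dimension with respect to this metric. (Points of $\mathcal{G}(F)$ are pairs consisting of a number and a compact set.) *)

(* Defs.v *)
From HB Require Import structures.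
From mathcomp Require Import all_boot all_order all_algebra.
From mathcomp Require Import all_classical all_reals all_analysis.

Set Implicit Arguments.
Unset Strict Implicit.
Unset Printing Implicit Defensive.

Import Order.TTheory GRing.Theory Num.Theory.
Import numFieldNormedType.Exports.

Local Open Scope classical_set_scope.
Local Open Scope ring_scope.

Record compacts (R : realType) (T : metricType R) := Compacts {
  compacts_set :> set T;
  compacts_neq0 : compacts_set !=set0;
  compacts_compact : compact compacts_set }.

HB.instance Definition _ (R : realType) (T : metricType R) :=
  gen_eqMixin (compacts T).
HB.instance Definition _ (R : realType) (T : metricType R) :=
  gen_choiceMixin (compacts T).

Section HausdorffMetric.
Context {R : realType} {T : metricType R}.
Implicit Types (A B C : compacts T) (S : set T) (x y : T).

Definition dist_to x S : R := inf [set mdist x y | y in S].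

Definition excess S1 S2 : R := sup [set dist_to x S2 | x in S1].

(* In R the suprema and infima are bounded only for nonempty compact sets
   (sup and inf default to 0 otherwise), hence the typing of the arguments. *)
Definition hausdorff_dist A B : R := Num.max (excess A B) (excess B A).

Lemma dist_to_lbound x S : has_lbound [set mdist x y | y in S].
Proof. by exists 0 => _ [y _ <-]; exact: mdist_ge0. Qed.

Lemma dist_to_le x y S : S y -> dist_to x S <= mdist x y.
Proof. by move=> Sy; apply: ge_inf; [exact: dist_to_lbound|exists y]. Qed.

Lemma dist_to_ge0 x B : 0 <= dist_to x B.
Proof.
apply: lb_le_inf; first by have [b Bb] := compacts_neq0 B; exists (mdist x b), b.
by move=> _ [y _ <-]; exact: mdist_ge0.
Qed.

Lemma dist_to_adherent x B e : 0 < e ->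
  exists2 b, compacts_set B b & mdist x b < dist_to x B + e.
Proof.
move=> e0; have iB : has_inf [set mdist x y | y in B].
  split; last exact: dist_to_lbound.
  by have [b Bb] := compacts_neq0 B; exists (mdist x b), b.
by have [_ [b Bb <-] xb] := inf_adherent e0 iB; exists b.
Qed.

Lemma excess_ubound A B : has_ubound [set dist_to x B | x in A].
Proof.
have [b Bb] := compacts_neq0 B.
have /compact_near_coveringP/(_ R +oo (fun M x => mdist x b <= M)) :=
  @compacts_compact _ _ A.
move=> /(_ _)[x Ax|M [_ MP]].
  exists (ball x 1, [set M : R | mdist x b + 1 <= M]).
    split => /=; first exact: nbhsx_ballx.
    by apply: nbhs_pinfty_ge; exact: num_real.
  move=> [y M] /= [xy xM]; apply: le_trans xM.
  apply: (le_trans (metric_triangle _ x _)).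
  by rewrite addrC lerD2l metric_sym ltW//; move: xy; rewrite ballEmdist.
exists (M + 1) => _ [x Ax <-].
apply: (le_trans (dist_to_le _ Bb)).
by apply: (MP (M + 1)) => //; rewrite ltrDl.
Qed.

Lemma dist_to_le_excess A B x :
  compacts_set A x -> dist_to x B <= excess A B.
Proof. by move=> Ax; apply: ub_le_sup; [exact: excess_ubound|exists x]. Qed.

Lemma excess_le A B r :
  (forall x, compacts_set A x -> dist_to x B <= r) -> excess A B <= r.
Proof.
move=> Ar; apply: ge_sup; last by move=> _ [x Ax <-]; exact: Ar.
by have [a Aa] := compacts_neq0 A; exists (dist_to a B), a.
Qed.

Lemma excess_ge0 A B : 0 <= excess A B.
Proof.
have [a Aa] := compacts_neq0 A.
exact: le_trans (dist_to_ge0 a B) (dist_to_le_excess _ Aa).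
Qed.

Lemma excess_triangle B A C : excess A C <= excess A B + excess B C.
Proof.
apply: excess_le => x Ax; apply/ler_addgt0Pl => e e0.
have e20 : 0 < e / 2 by rewrite divr_gt0.
have [b Bb xb] := dist_to_adherent x B e20.
have [c Cc bc] := dist_to_adherent b C e20.
apply: (le_trans (dist_to_le _ Cc)); apply: (le_trans (metric_triangle _ b _)).
apply: (le_trans (lerD (ltW xb) (ltW bc))).
rewrite addrACA -splitr addrC lerD2l.
by apply: lerD; exact: dist_to_le_excess.
Qed.

Lemma excess0_subset A B : excess A B = 0 -> compacts_set A `<=` compacts_set B.
Proof.
move=> AB0 x Ax.
apply: (compact_closed (@metric_hausdorff _ _) (@compacts_compact _ _ B)).
move=> U; rewrite -filter_from_ballE => -[e /= e0 xeU].
have [b Bb xb] := dist_to_adherent x B e0.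
exists b; split=> //; apply: xeU; rewrite ballEmdist/=.
apply: (lt_le_trans xb); rewrite gerDr.
by rewrite -AB0; exact: dist_to_le_excess.
Qed.

Lemma hausdorff_distxx A : hausdorff_dist A A = 0.
Proof.
rewrite /hausdorff_dist maxxx; apply/le_anti; rewrite excess_ge0 andbT.
by apply: excess_le => x Ax; rewrite -(mdistxx x); exact: dist_to_le.
Qed.

Lemma hausdorff_dist_positivity A B : hausdorff_dist A B = 0 -> A = B.
Proof.
move=> AB0.
have AB : excess A B = 0.
  by apply/le_anti; rewrite excess_ge0 -AB0 /hausdorff_dist le_max lexx.
have BA : excess B A = 0.
  by apply/le_anti; rewrite excess_ge0 -AB0 /hausdorff_dist le_max lexx orbT.
have : compacts_set A = compacts_set B.
  by apply/seteqP; split; exact: excess0_subset.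
case: A B {AB0 AB BA} => [A A0 cA] [B B0 cB] /= AB.
by case: B / AB B0 cB => B0 cB; congr Compacts; exact: Prop_irrelevance.
Qed.

Lemma hausdorff_dist_sym A B : hausdorff_dist A B = hausdorff_dist B A.
Proof. exact: maxC. Qed.

Lemma hausdorff_dist_triangle B A C :
  hausdorff_dist A C <= hausdorff_dist A B + hausdorff_dist B C.
Proof.
rewrite {1}/hausdorff_dist ge_max; apply/andP; split.
  apply: (le_trans (excess_triangle B _ _)).
  by apply: lerD; rewrite /hausdorff_dist le_max lexx.
apply: (le_trans (excess_triangle B _ _)); rewrite addrC.
by apply: lerD; rewrite /hausdorff_dist le_max lexx orbT.
Qed.

HB.instance Definition _ := isMetric.Build R (compacts T)
  hausdorff_distxx hausdorff_dist_positivity hausdorff_dist_sym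
  hausdorff_dist_triangle.

End HausdorffMetric.

(* An alias of S * T, whose own pseudometric is the maximum of the two
   component distances, carrying their sum instead. *)
Definition sum_prod (R : realType) (S T : metricType R) := (S * T)%type.

Section SumMetric.
Context {R : realType} {S T : metricType R}.
Implicit Types p q : sum_prod S T.

Definition sum_dist p q : R := mdist p.1 q.1 + mdist p.2 q.2.

Lemma sum_distxx p : sum_dist p p = 0.
Proof. by rewrite /sum_dist !mdistxx addr0. Qed.

Lemma sum_dist_positivity p q : sum_dist p q = 0 -> p = q.
Proof.
move/eqP; rewrite paddr_eq0 ?mdist_ge0// => /andP[/eqP p1 /eqP p2].
case: p q p1 p2 => [p1 p2] [q1 q2] /= h1 h2.
by rewrite (mdist_positivity _ _ h1) (mdist_positivity _ _ h2).
Qed.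

Lemma sum_dist_sym p q : sum_dist p q = sum_dist q p.
Proof. by congr (_ + _); exact: metric_sym. Qed.

Lemma sum_dist_triangle q p r : sum_dist p r <= sum_dist p q + sum_dist q r.
Proof. by rewrite /sum_dist addrACA lerD// metric_triangle. Qed.

HB.instance Definition _ := Choice.on (sum_prod S T).
HB.instance Definition _ := isMetric.Build R (sum_prod S T)
  sum_distxx sum_dist_positivity sum_dist_sym sum_dist_triangle.

Definition graph_on (D : set S) (f : S -> T) : set (sum_prod S T) :=
  [set (x, f x) | x in D].

End SumMetric.

Section HausdorffDimension.
Context {R : realType} {T : metricType R}.
Local Open Scope ereal_scope.
Implicit Types (A U : set T) (s delta : R).

(* diam set0 = -oo *)
Definition diam U : \bar R :=
  ereal_sup [set (mdist p.1 p.2)%:E | p in U `*` U].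

(* |U|^s, with |U|^0 = 1 for every nonempty U; the empty set contributes 0
   for every s, so that a sequence of sets also encodes the finite covers. *)
Definition diam_pow s U : \bar R := if U == set0 then 0 else diam U `^ s.

Definition hausdorff_premeasure s delta A : \bar R :=
  ereal_inf [set \sum_(0 <= i <oo) diam_pow s (U i) |
    U in [set U : nat -> set T |
      A `<=` \bigcup_i U i /\ forall i, diam (U i) <= delta%:E]].

Definition hausdorff_measure s A : \bar R :=
  ereal_sup [set hausdorff_premeasure s delta A |
    delta in [set delta | (0 < delta)%R]].

Definition hausdorff_dim A : \bar R :=
  ereal_inf [set s%:E |
    s in [set s | (0 <= s)%R /\ hausdorff_measure s A = 0]].

End HausdorffDimension.

(* Main.v *)
Require Import Defs.
From HB Require Import structures.
From mathcomp Require Import all_boot all_order all_algebra.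
From mathcomp Require Import all_classical all_reals all_analysis.
From mathcomp Require Import lra.

Set Implicit Arguments.
Unset Strict Implicit.
Unset Printing Implicit Defensive.

Import Order.TTheory GRing.Theory Num.Theory.
Import numFieldNormedType.Exports.

Local Open Scope classical_set_scope.
Local Open Scope ring_scope.

(** The graph map [u |-> (u, F u)] sends [[0, 1]] onto the graph and is
    Lipschitz with constant [1 + l] for the sum metric, while the first
    projection maps the graph back onto [[0, 1]] without increasing distances.
    Each direction gives one inequality.

    Upper bound ([hausdorff_dim_lipschitz_itv01]): cut [[0, 1]] into pieces of
    length at most [1 / N].  The images under an [L]-Lipschitz map have diameter
    at most [L / N], so the [s]-th powers of the diameters add up to at most
    about [N (L / N)^s = L (L / N)^(s - 1)], which tends to [0] for every
    [s > 1].

    Lower bound ([hausdorff_dim_ge1]): if [s < 1] and the [s]-dimensional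
    measure vanished, there would be covers by sets of diameter at most [1] whose
    [s]-th powers of diameters have an arbitrarily small sum.  As [d <= d^s] for
    [0 <= d <= 1], the images of the covering sets under the projection would lie
    in intervals covering [[0, 1]] of arbitrarily small total length, against the
    countable subadditivity of Lebesgue measure ([cover_itv01_sum]). *)

(** * Diameters *)

(** The distance and the norm of the line are tied together only through the
    balls, hence the comparison of both sides with an arbitrary radius. *)
Lemma mdist_norm (R : realType) (x y : R^o) : mdist x y = `|x - y|.
Proof.
have ltE d : (mdist x y < d) = (`|x - y| < d).
  have : ball x d y = ball_ Num.norm x d y by rewrite ball_normE.
  by rewrite ballEmdist => /= e; apply/idP/idP; rewrite e.
by apply/le_anti; rewrite !leNgt -ltE ltxx ltE ltxx.
Qed.

Section Diameter.
Context {R : realType} {T : metricType R}.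
Implicit Types U : set T.
Local Open Scope ereal_scope.

Lemma diam_le U (d : R) :
  (forall x y, U x -> U y -> (mdist x y <= d)%R) -> diam U <= d%:E.
Proof.
move=> Ud; apply: ge_ereal_sup => _ [[x y] [/= Ux Uy] <-].
by rewrite lee_fin; exact: Ud.
Qed.

Lemma mdist_le_diam U x y : U x -> U y -> (mdist x y)%:E <= diam U.
Proof. by move=> Ux Uy; apply: ereal_sup_ubound; exists (x, y). Qed.

Lemma diam_ge0 U : U !=set0 -> 0 <= diam U.
Proof. by case=> x Ux; have := mdist_le_diam Ux Ux; rewrite mdistxx. Qed.

Lemma diam_pow_ge0 s U : 0 <= diam_pow s U.
Proof. by rewrite /diam_pow; case: ifP => // _; exact: poweR_ge0. Qed.

Lemma diam_pow_le s d U : (0 <= s)%R -> (0 <= d)%R -> diam U <= d%:E ->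
  diam_pow s U <= (d `^ s)%:E.
Proof.
move=> s0 d0 Ud; rewrite /diam_pow; case: ifPn => [_|/set0P U0].
  by rewrite lee_fin powR_ge0.
rewrite -poweR_EFin; apply: gt0_ler_poweR => //.
  by rewrite in_itv/= diam_ge0// leey.
by rewrite in_itv/= lee_fin d0 leey.
Qed.

(** This is where the exponents below [1] differ from those above: on [[0, 1]]
    one has [d <= d^s] as soon as [s <= 1]. *)
Lemma mdist_le_diam_pow s U x y : (s <= 1)%R -> diam U <= 1 ->
  U x -> U y -> (mdist x y)%:E <= diam_pow s U.
Proof.
move=> s1 U1 Ux Uy; have U0 : U !=set0 by exists x.
rewrite /diam_pow ifN; last exact/set0P.
apply: (le_trans (mdist_le_diam Ux Uy)).
have := diam_ge0 U0; move: U1; case: (diam U) => [d| |]//.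
rewrite poweR_EFin !lee_fin => d1; rewrite le_eqVlt => /predU1P[<-|d0].
  exact: powR_ge0.
by apply: ger1_powR => //; rewrite d0.
Qed.

End Diameter.

(** * Lower bound: projecting a cover to the line *)

Section LowerBound.
Context {R : realType} {T : metricType R}.
Local Open Scope ereal_scope.

(** The image of [U i] under a 1-Lipschitz map lies in the interval of radius
    [(diam (U i))^s] around the image of any of its points.  The factor [2] is
    the ratio of the length of such an interval to its radius; it is harmless,
    as what matters is that the sum stays away from [0]. *)
Lemma cover_itv01_sum (p : T -> R) (A : set T) (U : nat -> set T) (s : R) :
  (forall x y, (`|p x - p y| <= mdist x y)%R) ->
  `[0%R, 1%R] `<=` p @` A -> A `<=` \bigcup_i U i ->
  (forall i, diam (U i) <= 1) -> (0 <= s <= 1)%R ->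
  1 <= 2%:E * \sum_(0 <= i <oo) diam_pow s (U i).
Proof.
move=> p1 pA AU U1 /andP[s0 s1].
pose r i := fine (diam_pow s (U i)).
have rE i : (r i)%:E = diam_pow s (U i).
  rewrite fineK// ge0_fin_numE ?diam_pow_ge0//.
  by rewrite (le_lt_trans (diam_pow_le s0 ler01 (U1 i)))// ltry.
have r0 i : (0 <= r i)%R by rewrite -lee_fin rE diam_pow_ge0.
have /choice[c cU] i : exists c : R, forall x, U i x -> (`|c - p x| <= r i)%R.
  (* An empty piece has radius 0, so any centre serves. *)
  have [->|/set0P[z Uz]] := eqVneq (U i) set0; first by exists 0%R.
  exists (p z) => x Ux; apply: (le_trans (p1 _ _)).
  by rewrite -lee_fin rE; exact: mdist_le_diam_pow.
pose I i := [set` `[c i - r i, c i + r i]%R].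
have I01 : `[0%R, 1%R] `<=` \bigcup_i I i.
  move=> t /pA[x /AU[i _ Ux] <-]; exists i => //.
  by rewrite /I /= in_itv/= -ler_distlC; exact: cU.
have lebI i : lebesgue_measure (I i) = 2%:E * diam_pow s (U i).
  rewrite /I lebesgue_measure_itv/= lte_fin -rE -EFinM; case: ltP => [_|].
    rewrite -EFinB; congr EFin.
    by rewrite opprB addrC addrA subrK mulr_natl mulr2n.
  rewrite lerBrDr -addrA gerDl => rr.
  suff -> : r i = 0%R by rewrite mulr0.
  by apply/le_anti; rewrite r0 andbT (le_trans _ rr)// lerDl.
have mI i : measurable (I i : set (measurableTypeR R)).
  exact: measurable_itv.
have leb01 : lebesgue_measure (`[0%R, 1%R] : set R) = 1.
  by rewrite lebesgue_measure_itv/= lte_fin ltr01 oppr0 adde0.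
have : lebesgue_measure (`[0%R, 1%R] : set R) <=
    \sum_(0 <= i <oo) lebesgue_measure (I i).
  exact: (measure_sigma_subadditive _ mI (measurable_itv `[0%R, 1%R]) I01).
rewrite leb01 => /le_trans; apply.
rewrite -nneseriesZl => [|i _]; last exact: diam_pow_ge0.
by under eq_eseriesr do rewrite lebI.
Qed.

Lemma hausdorff_dim_ge1 (p : T -> R) (A : set T) :
  (forall x y, (`|p x - p y| <= mdist x y)%R) ->
  `[0%R, 1%R] `<=` p @` A -> 1 <= hausdorff_dim A.
Proof.
move=> p1 pA; apply: le_ereal_inf_tmp => _ [s [s0 As0] <-].
rewrite lee_fin leNgt; apply/negP => s1.
(* 2^-1 is what contradicts the covering estimate, because of its factor 2. *)
have : hausdorff_premeasure s 1 A < (2^-1)%:E.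
  apply: (@le_lt_trans _ _ 0); last by rewrite lte_fin invr_gt0.
  by rewrite -As0; apply: ereal_sup_ubound; exists 1%R => /=.
move=> /ereal_inf_lt[_ [U [AU U1] <-] Ulow].
have s01 : (0 <= s <= 1)%R by rewrite s0 ltW.
have := cover_itv01_sum p1 pA AU U1 s01; apply/negP; rewrite -ltNge.
have <- : 2%:E * (2^-1)%:E = 1 :> \bar R by rewrite -EFinM divff.
by rewrite lte_pmul2l.
Qed.

End LowerBound.

(** * Upper bound: Lipschitz images of the unit interval *)

Section UpperBound.
Context {R : realType} {T : metricType R}.
Context (g : R -> T) (L : R) (L_gt0 : 0 < L).
Context (g_lip : forall u w : R, u \in `[0, 1] -> w \in `[0, 1] ->
  mdist (g u) (g w) <= L * `|u - w|).

(** The cover groups the points of [[0, 1]] by the integer part of [x * N].  It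
    has [N + 1] nonempty members, the last coming from [x = 1] alone; bounding
    [N + 1] by [2 * N] accounts for the factor [2]. *)
Lemma hausdorff_premeasure_lipschitz_itv01 (s delta : R) (N : nat) :
  (0 < N)%N -> 0 < s -> L / N%:R <= delta ->
  (hausdorff_premeasure s delta (g @` `[0%R, 1%R]) <=
   (2 * L * (L / N%:R) `^ (s - 1))%:E)%E.
Proof.
move=> N0 s0 Ndelta; have N0R : 0 < N%:R :> R by rewrite ltr0n.
have LN0 : 0 <= L / N%:R by rewrite divr_ge0 ?ler0n// ltW.
pose U i := g @` [set x : R | x \in `[0, 1] /\ Num.truncn (x * N%:R) = i].
have U_diam i : (diam (U i) <= (L / N%:R)%:E)%E.
  apply: diam_le => _ _ [x [x01 xi] <-] [y [y01 yi] <-].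
  apply: (le_trans (g_lip x01 y01)); rewrite ler_pM2l//.
  have itv (z : R) : z \in `[0, 1] -> Num.truncn (z * N%:R) = i ->
      i%:R <= z * N%:R < i%:R + 1.
    rewrite in_itv/= => /andP[z0 _] zi.
    have /truncn_itv : 0 <= z * N%:R by rewrite mulr_ge0// ltW.
    by rewrite zi -natr1.
  have /andP[xl xu] := itv _ x01 xi; have /andP[yl yu] := itv _ y01 yi.
  rewrite -div1r ler_pdivlMr// -(gtr0_norm N0R) -normrM.
  by rewrite mulrBl ler_norml; apply/andP; split; lra.
have U_empty i : (N < i)%N -> U i = set0.
  move=> Ni; apply/seteqP; split=> // y [x [x01 xi] _]; exfalso.
  move: Ni; apply/negP; rewrite -leqNgt -xi -(ler_nat R).
  move: x01; rewrite in_itv/= => /andP[x0 x1].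
  have /truncn_itv/andP[+ _] : 0 <= x * N%:R by rewrite mulr_ge0// ltW.
  by move/le_trans; apply; rewrite ler_piMl// ltW.
apply: ge_ereal_inf; exists (\sum_(0 <= i <oo) diam_pow s (U i))%E.
  exists U => //; split=> [_ [x x01 <-]|i].
    by exists (Num.truncn (x * N%:R)) => //; exists x.
  by rewrite (le_trans (U_diam i))// lee_fin.
rewrite (nneseries_split _ N.+1) => [|i _]; last exact: diam_pow_ge0.
rewrite [X in (_ + X)%E]eseries0 => [|i /= Ni _]; last first.
  by rewrite /diam_pow U_empty ?eqxx.
rewrite adde0.
apply: (@le_trans _ _ (\sum_(0 <= i < N.+1) ((L / N%:R) `^ s)%:E)%E).
  by apply: lee_sum => i _; apply: diam_pow_le => //; exact: ltW.
rewrite sumEFin sumr_const_nat subn0 lee_fin -(mulr_powRB1 LN0 s0).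
rewrite -[leLHS]mulr_natl mulrA ler_wpM2r ?powR_ge0//.
rewrite mulrCA [leRHS]mulrC ler_pM2l// ler_pdivrMr//.
by rewrite -natrM ler_nat mul2n -addnn -addn1 leq_add2l.
Qed.

(** The dimension is an infimum, so it suffices that the measure of exponent
    [1 + e] vanishes for every [e > 0]. *)
Lemma hausdorff_dim_lipschitz_itv01 :
  (hausdorff_dim (g @` `[0%R, 1%R]) <= 1)%E.
Proof.
apply/lee_addgt0Pr => e e0; rewrite -EFinD.
apply: ereal_inf_lbound; exists (1 + e) => //; split; first by lra.
apply/le_anti/andP; split; last first.
  apply: (le_trans _ (ereal_sup_ubound _)); last by exists 1 => //=.
  apply: le_ereal_inf_tmp => _ [U _ <-].
  by apply: nneseries_ge0 => i _ _; exact: diam_pow_ge0.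
apply: ge_ereal_sup => _ [delta /= delta0 <-].
apply/lee_addgt0Pr => eta eta0; rewrite add0e.
(* [N] is chosen so that [L / N] is at most [delta] and at most the solution [x]
   of [2 * L * x^e = eta]. *)
pose q := eta / (2 * L).
have q0 : 0 < q by rewrite divr_gt0// mulr_gt0.
pose t := Num.min delta (q `^ e^-1).
have t0 : 0 < t by rewrite lt_min delta0 powR_gt0.
pose N := (Num.truncn (L / t)).+1.
have LNt : L / N%:R <= t.
  rewrite ler_pdivrMr ?ltr0n// mulrC -ler_pdivrMr//.
  by have /truncn_itv/andP[_ /ltW] : 0 <= L / t by rewrite divr_ge0// ltW.
apply: (le_trans (@hausdorff_premeasure_lipschitz_itv01 _ _ N _ _ _)) => //.
- by lra.
- by rewrite (le_trans LNt)// ge_min lexx.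
rewrite lee_fin mulrC -ler_pdivlMr ?mulr_gt0// addrAC subrr add0r -/q.
have -> : q = (q `^ e^-1) `^ e by rewrite -powRrM mulVf ?gt_eqF// powRr1// ltW.
apply: ge0_ler_powR; rewrite ?nnegrE ?powR_ge0//; first exact: ltW.
  by rewrite divr_ge0// ltW.
by rewrite (le_trans LNt)// ge_min lexx orbT.
Qed.

End UpperBound.

Theorem theorem5p10 (R : realType) (F : R -> compacts R^o) (l : R)
  (F_lipschitz : forall u w : R, u \in `[0, 1] -> w \in `[0, 1] ->
     hausdorff_dist (F u) (F w) <= l * `|u - w|) :
  hausdorff_dim (graph_on (`[0, 1] : set R^o) F) = 1%E.
Proof.
(* The Lipschitz bound at the pair 0, 1 forces [l] to be nonnegative. *)
have l0 : 0 <= l.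
  have := F_lipschitz 0 1; rewrite !in_itv/= !lexx ler01 sub0r normrN1 mulr1.
  move=> /(_ isT isT); apply: le_trans.
  exact: (@mdist_ge0 _ (compacts R^o)).
apply/le_anti/andP; split.
  apply: (@hausdorff_dim_lipschitz_itv01 _ (sum_prod R^o (compacts R^o))
    (fun u => (u, F u)) (1 + l)) => [|u w u01 w01]; first by lra.
  rewrite mulrDl mul1r; apply: lerD; first by rewrite mdist_norm.
  exact: F_lipschitz.
apply: (@hausdorff_dim_ge1 _ (sum_prod R^o (compacts R^o)) fst) => [x y|u u01].
  by rewrite -mdist_norm; apply: ler_wpDr => //; exact: mdist_ge0.
by exists (u, F u) => //; exists u.
Qed.
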